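(* Let $G$ be a group, $X$ a non-empty set and $\pi:G\times G\to\mathrm{Sym}(X)$, $\pi(a,b)=:\pi_{a,b}$, a map such that $\pi_{a^{-1}b,\,a^{-1}c}\,\pi_{a,c}=\pi_{b,c}$ for all $a,b,c\in G$. Then the pair $(X\times G,s)$ given by $s((x,a),(y,b)):=((x,a),(\pi_{a,b}(y),a^{-1}b))$ is a bijective commutative non-degenerate solution on the left-zero semigroup having $X\times G$ as underlying set. Moreover, $\mathrm{Ret}(X\times G,s)\cong(G,s_G)$, where $s_G(g,h)=(g,g^{-1}h)$. Conversely, every finite commutative non-degenerate solution on a left-zero semigroup can be constructed in this way (up to isomorphism of solutions).
   Context: A solution (set-theoretic solution of the Pentagon Equation) is a pair $(S,s)$ with $S$ a non-empty set and $s:S\times S\to S\times S$ a map such that $s_{23}s_{13}s_{12}=s_{12}s_{23}$ as maps $S^3\to S^3$, where $s_{12}=s\times \mathrm{id}$, $s_{23}=\mathrm{id}\times s$, $s_{13}=(\tau\times \mathrm{id})(\mathrm{id}\times s)(\tau\times \mathrm{id})$ and $\tau(x,y)=(y,x)$. Writing $s(x,y)=(x\cdot y,\theta_x(y))$, the pair $(S,s)$ is a solution if and only if for all $x,y,z\in S$: $(x\cdot y)\cdot z=x\cdot(y\cdot z)$, $\theta_x(y)\cdot\theta_{x\cdot y}(z)=\theta_x(y\cdot z)$, and $\theta_{\theta_x(y)}\theta_{x\cdot y}=\theta_y$; one says $(S,s)$ is a solution on the semigroup $(S,\cdot)$. It is finite if $S$ is finite, bijective if $s$ is bijective. It is commutative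 if $s_{12}s_{13}=s_{13}s_{12}$, equivalently $x\cdot y\cdot z=x\cdot z\cdot y$ and $\theta_{x\cdot y}=\theta_x$ for all $x,y,z\in S$. It is non-degenerate if every $\theta_x:S\to S$ is bijective. A semigroup is left-zero if $x\cdot y=x$ for all $x,y$. For a commutative non-degenerate solution, the retract relation is $x\sim y\iff\theta_x=\theta_y$; the retraction $\mathrm{Ret}(S,s)$ is the induced solution on $S/\!\sim$ given by $\bar s(\bar x,\bar y)=(\overline{x\cdot y},\overline{\theta_x(y)})$. Two solutions $(S,s)$, $(T,t)$ are isomorphic ($\cong$) if there is a bijection $\phi:S\to T$ with $(\phi\times\phi)s=t(\phi\times\phi)$. *)

(* Defs.v *)
From HB Require Import structures.
From mathcomp Require Import all_boot generic_quotient.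
From mathcomp Require Import boolp.

Set Implicit Arguments.
Unset Strict Implicit.
Unset Printing Implicit Defensive.

Section Solutions.
Variable S : Type.
Implicit Type s : S * S -> S * S.

Definition flip12 (t : S * S * S) : S * S * S :=
  let: (x, y, z) := t in (y, x, z).

Definition map12 s (t : S * S * S) : S * S * S :=
  let: (x, y, z) := t in let: (x', y') := s (x, y) in (x', y', z).

Definition map23 s (t : S * S * S) : S * S * S :=
  let: (x, y, z) := t in let: (y', z') := s (y, z) in (x, y', z').

Definition map13 s : S * S * S -> S * S * S := flip12 \o map23 s \o flip12.

Definition solution s : Prop :=
  inhabited S /\ map23 s \o map13 s \o map12 s =1 map12 s \o map23 s.

Definition sdot s (x y : S) : S := (s (x, y)).1.

Definition theta s (x y : S) : S := (s (x, y)).2.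

Definition commutative_solution s : Prop :=
  map12 s \o map13 s =1 map13 s \o map12 s.

Definition nondegenerate s : Prop := forall x, bijective (theta s x).

Definition on_left_zero s : Prop := forall x y, sdot s x y = x.

Definition retract_rel s : rel {classic S} :=
  fun x y => `[< theta s x = theta s y >].

Lemma retract_rel_refl s : reflexive (retract_rel s).
Proof. by move=> x; apply/asboolP. Qed.

Lemma retract_rel_sym s : symmetric (retract_rel s).
Proof. by move=> x y; apply/asboolP/asboolP. Qed.

Lemma retract_rel_trans s : transitive (retract_rel s).
Proof. by move=> y x z /asboolP e /asboolP e'; apply/asboolP; rewrite e. Qed.

Canonical retract_equiv s :=
  EquivRel (retract_rel s) (@retract_rel_refl s) (@retract_rel_sym s)
    (@retract_rel_trans s).

Definition Ret s := {eq_quot (retract_equiv s)}%qT.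

Definition ret_class s (x : S) : Ret s := (\pi_(Ret s) x)%qT.

Definition ret_repr s (c : Ret s) : S := repr c.

(* Computed on chosen representatives; independent of the choice for a
   commutative non-degenerate solution, see [ret_mapE]. *)
Definition ret_map s (p : Ret s * Ret s) : Ret s * Ret s :=
  let x := ret_repr p.1 in let y := ret_repr p.2 in
  (ret_class s (sdot s x y), ret_class s (theta s x y)).

Lemma ret_classP s x y :
  ret_class s x = ret_class s y <-> theta s x = theta s y.
Proof.
rewrite /ret_class; split=> [/eqP|e].
  by rewrite eqmodE => /asboolP.
by apply/eqP; rewrite eqmodE; apply/asboolP.
Qed.

Lemma ret_reprK s c : ret_class s (@ret_repr s c) = c.
Proof. by rewrite /ret_class /ret_repr reprK. Qed.

Lemma pentagonP s :
  map23 s \o map13 s \o map12 s =1 map12 s \o map23 s <->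
  forall x y z,
    [/\ sdot s (sdot s x y) z = sdot s x (sdot s y z),
        sdot s (theta s x y) (theta s (sdot s x y) z) = theta s x (sdot s y z)
      & theta s (theta s x y) (theta s (sdot s x y) z) = theta s y z].
Proof.
split=> [h x y z|h [[x y] z]].
  have := h (x, y, z); rewrite /map13 /map12 /map23 /flip12 /= /sdot /theta.
  case: (s (x, y)) => a b /=; case: (s (a, z)) => c d /=.
  case: (s (b, d)) => e f /=; case: (s (y, z)) => g k /=.
  by case: (s (x, g)) => m n /= [-> -> ->].
have := h x y z; rewrite /map13 /map12 /map23 /flip12 /= /sdot /theta.
case: (s (x, y)) => a b /=; case: (s (a, z)) => c d /=.
case: (s (b, d)) => e f /=; case: (s (y, z)) => g k /=.
by case: (s (x, g)) => m n /= [-> -> ->].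
Qed.

Lemma commutative_solutionP s :
  commutative_solution s <->
  forall x y z, sdot s (sdot s x y) z = sdot s (sdot s x z) y /\
                theta s (sdot s x y) = theta s x.
Proof.
have E x y z : (map12 s \o map13 s) (x, y, z) =
    (sdot s (sdot s x z) y, theta s (sdot s x z) y, theta s x z).
  rewrite /map13 /map12 /map23 /flip12 /= /sdot /theta.
  by case: (s (x, z)) => a b /=; case: (s (a, y)).
have E' x y z : (map13 s \o map12 s) (x, y, z) =
    (sdot s (sdot s x y) z, theta s x y, theta s (sdot s x y) z).
  rewrite /map13 /map12 /map23 /flip12 /= /sdot /theta.
  by case: (s (x, y)) => a b /=; case: (s (a, z)).
split=> [h x y z|h [[x y] z]]; last first.
  by rewrite E E'; case: (h x y z) => -> ->; case: (h x z y) => _ ->.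
by split; [|apply/funext => w; move: (h (x, y, w))]; [move: (h (x, y, z))|];
  rewrite E E' => -[].
Qed.

Lemma ret_mapE s (x y : S) :
  solution s -> commutative_solution s -> nondegenerate s ->
  ret_map (ret_class s x, ret_class s y) =
  (ret_class s (sdot s x y), ret_class s (theta s x y)).
Proof.
move=> hs /commutative_solutionP hc hn; have [_ /pentagonP hp] := hs.
have thM u v : theta s (sdot s u v) = theta s u by case: (hc u v u).
have tht u v w : theta s (theta s u v) (theta s u w) = theta s v w.
  by case: (hp u v w) => _ _; rewrite thM.
rewrite /ret_map /=.
have /ret_classP ex := ret_reprK (ret_class s x).
have /ret_classP ey := ret_reprK (ret_class s y).
congr (_, _); apply/ret_classP; first by rewrite !thM.
apply/funext => z; have [g _ gK] := hn x.
by rewrite -(gK z) -{1}ex !tht ey.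
Qed.

End Solutions.

Lemma ret_map_solution (S : Type) (s : S * S -> S * S) :
  solution s -> commutative_solution s -> nondegenerate s ->
  solution (@ret_map S s).
Proof.
move=> hs hc hn; have [[x0] /pentagonP hp] := hs.
split; first by exists; exact: ret_class x0.
have dotE x y : sdot (@ret_map S s) (ret_class s x) (ret_class s y) =
                ret_class s (sdot s x y) by rewrite {1}/sdot ret_mapE.
have thE x y : theta (@ret_map S s) (ret_class s x) (ret_class s y) =
               ret_class s (theta s x y) by rewrite {1}/theta ret_mapE.
apply/pentagonP => c d e.
rewrite -(ret_reprK c) -(ret_reprK d) -(ret_reprK e) !(dotE, thE).
by case: (hp (ret_repr c) (ret_repr d) (ret_repr e)) => -> -> ->.
Qed.

Definition isomorphic (S T : Type) (s : S * S -> S * S) (t : T * T -> T * T) :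
    Prop :=
  exists f : S -> T, bijective f /\
    (fun p => (f (s p).1, f (s p).2)) =1 (fun p => t (f p.1, f p.2)).

Local Open Scope group_scope.

Definition group_map (G : groupType) (p : G * G) : G * G :=
  let: (g, h) := p in (g, g^-1 * h).

Definition family_map (G : groupType) (X : Type) (pi : G -> G -> X -> X)
    (p : (X * G) * (X * G)) : (X * G) * (X * G) :=
  let: ((x, a), (y, b)) := p in ((x, a), (pi a b y, a^-1 * b)).

(* Main.v *)
Require Import Defs.
From mathcomp Require Import all_boot.
From mathcomp Require Import fingroup perm boolp.
Local Open Scope group_scope.

(** On a left-zero semigroup the three solution axioms collapse to the single
    identity [theta_(theta_x y) theta_x = theta_y], the division law
    [left_zero_solutionP]; commutativity is then automatic.

    For [family_map pi] the division law reads, on the two coordinates, as the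
    cocycle identity for [pi] and as [(a^-1 b)^-1 (a^-1 c) = b^-1 c].  The map
    [theta_(x, a)] depends on [a] only and determines [a], since its second
    coordinate is left translation by [a^-1]; hence the classes of the retract
    relation are exactly the fibres of [X * G -> G].

    Conversely, when all [theta_x] are permutations the division law says that
    [theta_(theta_x y)] is the quotient of [theta_y] by [theta_x].  So the set
    [G] of all [theta_x] is non-empty and closed under division: it is a
    subgroup of the symmetric group of [S] ([theta_perms_group_set]).  Let [X]
    be the set of those [x] with [theta_x = 1].  Then [theta_y y] lies in [X]
    for every [y], and [y |-> (theta_y y, theta_y)] is a bijection from [S] to
    [X * G], with inverse [(x, g) |-> g^-1 x].  It carries [s] to [family_map pi]
    for the trivial family [pi = id], because the point
    [w = theta_x y] has [theta_w = theta_y theta_x^-1], hence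
    [theta_w w = theta_y y]: the first coordinate does not change. *)

(** * Solutions on left-zero semigroups *)

Lemma left_zero_solutionP (S : Type) (s : S * S -> S * S) :
  on_left_zero s ->
  solution s <->
  inhabited S /\
  forall x y z, theta s (theta s x y) (theta s x z) = theta s y z.
Proof.
move=> s0; split=> -[S0 sP]; split=> //.
  by move=> x y z; have /pentagonP/(_ x y z)[_ _] := sP; rewrite s0.
by apply/pentagonP => x y z; rewrite !s0.
Qed.

Lemma left_zero_commutative (S : Type) (s : S * S -> S * S) :
  on_left_zero s -> commutative_solution s.
Proof. by move=> s0; apply/commutative_solutionP => x y z; rewrite !s0. Qed.

(** * The solution attached to a cocycle of permutations *)

Section Family.
Variables (G : groupType) (X : Type) (pi : G -> G -> X -> X).
Hypothesis X_inhabited : inhabited X.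
Hypothesis pi_bij : forall a b, bijective (pi a b).
Hypothesis pi_cocycle :
  forall a b c, pi (a^-1 * b) (a^-1 * c) \o pi a c =1 pi b c.

Lemma family_left_zero : on_left_zero (family_map pi).
Proof. by move=> [x a] [y b]. Qed.

Lemma family_solution : solution (family_map pi).
Proof.
apply/left_zero_solutionP; first exact: family_left_zero.
split; first by case: X_inhabited => x; exists; exact: (x, 1).
move=> [x a] [y b] [z c]; rewrite /theta /=.
by rewrite -(pi_cocycle a b c) invgM invgK mulgA mulgK.
Qed.

Lemma family_nondegenerate : nondegenerate (family_map pi).
Proof.
move=> [x a].
have /choice[h hK] b : exists h, cancel (pi a b) h /\ cancel h (pi a b).
  by have [h] := pi_bij a b; exists h.
exists (fun p => (h (a * p.2) p.1, a * p.2)) => -[y b]; rewrite /theta /=.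
  by rewrite mulVKg; case: (hK b) => ->.
by rewrite mulKg; case: (hK (a * b)) => _ ->.
Qed.

(** With a left-zero product, [s (p, q) = (p, theta_p q)], so [s] can be
    inverted one fibre at a time. *)
Lemma family_bijective : bijective (family_map pi).
Proof.
have sE p q : family_map pi (p, q) = (p, theta (family_map pi) p q).
  by case: p q => [x a] [y b].
have /choice[h hK] p : exists h, cancel (theta (family_map pi) p) h /\
    cancel h (theta (family_map pi) p).
  by have [h] := family_nondegenerate p; exists h.
exists (fun r => (r.1, h r.1 r.2)) => -[p q]; rewrite sE //=.
  by case: (hK p) => ->.
by case: (hK p) => _ ->.
Qed.

(** The second coordinate of [theta_(x, a)] at the unit of [G] is [a^-1], which
    recovers [a]. *)
Lemma family_thetaP (p q : X * G) :
  theta (family_map pi) p = theta (family_map pi) q <-> p.2 = q.2.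
Proof.
case: p q => [x a] [y b] /=; split=> [e|->]; last by apply/funext => -[].
have := congr1 (fun f => (f (x, 1)).2) e.
by rewrite /theta /= !mulg1 => /invg_inj.
Qed.

Lemma family_repr (p : X * G) :
  (ret_repr (ret_class (family_map pi) p)).2 = p.2.
Proof. by apply/family_thetaP/ret_classP; rewrite ret_reprK. Qed.

(** By [family_thetaP] the second coordinate is constant on retract classes and
    separates them; any base point of [X] gives the inverse. *)
Lemma family_retraction :
  isomorphic (@ret_map (X * G) (family_map pi)) (@group_map G).
Proof.
exists (fun c => (ret_repr c).2); split.
  have [x] := X_inhabited.
  exists (fun g => ret_class (family_map pi) (x, g)) => [c|g]; last first.
    by rewrite family_repr.
  by rewrite -[RHS]ret_reprK; apply/ret_classP/family_thetaP.
move=> [c d]; rewrite /ret_map /= !family_repr /sdot /theta.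
by case: (ret_repr c) (ret_repr d) => [x a] [y b].
Qed.

End Family.

(** * Finite left-zero solutions and their permutation group *)

Section Converse.
Variables (S : finType) (s : S * S -> S * S).
Hypothesis s_sol : solution s.
Hypothesis s_nondeg : nondegenerate s.
Hypothesis s_left_zero : on_left_zero s.

Definition theta_perm (x : S) : {perm S} := perm (bij_inj (s_nondeg x)).

Lemma theta_permE (x : S) : theta_perm x =1 theta s x.
Proof. exact: permE. Qed.

Definition theta_perms : {set {perm S}} := [set theta_perm x | x : S].

(** This is the division law.  Products of permutations are applied from left to
    right, so [theta_y theta_x^-1] is written with the inverse on the left, which
    matches the second coordinate of [family_map]. *)
Lemma theta_perm_theta (x y : S) :
  theta_perm (theta s x y) = (theta_perm x)^-1 * theta_perm y.
Proof.
have [_ law] := (left_zero_solutionP _ _ s_left_zero).1 s_sol.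
by apply: (mulgI (theta_perm x)); apply/permP => z; rewrite mulKVg permM !theta_permE.
Qed.

(** By the division law, [theta_perms] is closed under [g^-1 * h]; being
    non-empty, it is a subgroup. *)
Lemma theta_perms_group_set : group_set theta_perms.
Proof.
have [[x0] _] := s_sol.
have div g h : g \in theta_perms -> h \in theta_perms ->
    g^-1 * h \in theta_perms.
  move=> /imsetP[x _ ->] /imsetP[y _ ->].
  by rewrite -theta_perm_theta imset_f.
have T0 : theta_perm x0 \in theta_perms by rewrite imset_f.
have T1 : 1 \in theta_perms by rewrite -(mulVg (theta_perm x0)) div.
apply/group_setP; split=> // g h Tg Th.
by rewrite -[g]invgK div // -[g^-1]mulg1 div.
Qed.

Canonical theta_group : {group {perm S}} := Group theta_perms_group_set.

Definition theta_kernel : Type := {x : S | theta_perm x == 1}.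

Definition theta_elt (x : S) : subg_of theta_group := subg _ (theta_perm x).

Lemma val_theta_elt (x : S) : sgval (theta_elt x) = theta_perm x.
Proof. by rewrite subgK //= imset_f. Qed.

Lemma theta_elt_theta (x y : S) :
  theta_elt (theta s x y) = (theta_elt x)^-1 * theta_elt y.
Proof.
by apply: val_inj; rewrite /= !val_theta_elt theta_perm_theta.
Qed.

Lemma theta_self_kernel (y : S) : theta_perm (theta s y y) == 1.
Proof. by rewrite theta_perm_theta mulVg. Qed.

(** Write [g = theta_z].  Then [theta_z] sends [g^-1 x] to [x], so by the division
    law [theta_x] is the quotient of [theta_(g^-1 x)] by [g]; it is trivial for
    [x] in the kernel. *)
Lemma theta_perm_kernelV (g : subg_of theta_group) (x : theta_kernel) :
  theta_perm ((sgval g)^-1 (val x)) = sgval g.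
Proof.
have /imsetP[z _ ->] := subgP g.
have : theta_perm (theta s z ((theta_perm z)^-1 (val x))) == 1.
  have -> : theta s z ((theta_perm z)^-1 (val x)) = val x.
    by rewrite -theta_permE permKV.
  exact: valP x.
by rewrite theta_perm_theta => /eqP/(canRL (mulKVg _)); rewrite mulg1.
Qed.

Lemma left_zero_isomorphic_family :
  isomorphic s (@family_map (subg_of theta_group) theta_kernel (fun _ _ => id)).
Proof.
have [_ law] := (left_zero_solutionP _ _ s_left_zero).1 s_sol.
exists (fun y => (Sub (theta s y y) (theta_self_kernel y), theta_elt y)).
split.
  exists (fun p : theta_kernel * subg_of theta_group =>
    (sgval p.2)^-1 (val p.1)) => [y|[x g]] /=.
    by rewrite val_theta_elt -theta_permE permK.
  have e := theta_perm_kernelV g x.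
  congr (_, _); apply: val_inj; rewrite /= ?val_theta_elt //.
  by rewrite -theta_permE e permKV.
move=> [x y] /=; have -> : (s (x, y)).1 = x by exact: s_left_zero.
rewrite -/(theta s x y) theta_elt_theta; congr (_, (_, _)).
by apply: val_inj; rewrite /= law.
Qed.

End Converse.

Theorem theorem24 :
  (forall (G : groupType) (X : Type) (pi : G -> G -> X -> X),
     inhabited X ->
     (forall a b : G, bijective (pi a b)) ->
     (forall a b c : G, pi (a^-1 * b) (a^-1 * c) \o pi a c =1 pi b c) ->
     [/\ solution (family_map pi),
         bijective (family_map pi),
         commutative_solution (family_map pi),
         nondegenerate (family_map pi)
       & on_left_zero (family_map pi)] /\
     isomorphic (@ret_map (X * G) (family_map pi)) (@group_map G)) /\
  (forall (S : finType) (s : S * S -> S * S),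
     solution s -> commutative_solution s -> nondegenerate s ->
     on_left_zero s ->
     exists (G : groupType) (X : Type) (pi : G -> G -> X -> X),
       [/\ inhabited X,
           forall a b : G, bijective (pi a b),
           forall a b c : G, pi (a^-1 * b) (a^-1 * c) \o pi a c =1 pi b c
         & isomorphic s (family_map pi)]).
Proof.
split=> [G X pi X0 pi_bij pi_cocycle | S s s_sol _ s_nondeg s_lz].
  split; last exact: family_retraction.
  split; [exact: family_solution | exact: family_bijective | |
    exact: family_nondegenerate | exact: family_left_zero].
  exact/left_zero_commutative/family_left_zero.
have [[x0] _] := s_sol.
exists (subg_of (theta_group _ _ s_sol s_nondeg s_lz)), (theta_kernel _ _ s_nondeg),
  (fun _ _ => id).
split=> //; first by exists; exists (theta s x0 x0); exact: theta_self_kernel.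
  by move=> _ _; exists id.
exact: left_zero_isomorphic_family.
Qed.
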